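(* Let $S$ be a metric semigroup with the Liouville property. Then $S$ is amenable.
   Context: A metric semigroup is a semigroup with a metrizable topology for which multiplication is jointly continuous. For $a\in S$ and $f:S\to\mathbb C$, $(\delta_a*f)(x)=f(ax)$. $LUC(S)$ is the space of bounded continuous functions $f:S\to\mathbb C$ such that $a\in S\mapsto\delta_a*f\in C_b(S)$ is continuous for the supremum norm. A probability measure $\pi$ on $S$ is tight if for every $\varepsilon>0$ there is a compact $K\subseteq S$ with $\pi(S\setminus K)<\varepsilon$. For a probability measure $\pi$ on $S$, $H_\pi(S)=\{f\in LUC(S): f(x)=\int_Sf(xy)\,d\pi(y)\ \text{for all }x\in S\}$. $S$ has the Liouville property if there is a tight probability measure $\pi$ on $S$ such that $H_\pi(S)=\mathbb C\mathbf 1$ (the constant functions). $S$ is amenable (left amenable) if there is a norm-one positive linear functional $\varphi:LUC(S)\to\mathbb C$ with $\varphi(\delta_a*f)=\varphi(f)$ for all $a\in S$ and $f\in LUC(S)$. *)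

(* Defs.v *)
From HB Require Import structures.
From mathcomp Require Import all_boot all_order all_algebra complex.
From mathcomp Require Import all_classical all_reals all_analysis.

Set Implicit Arguments.
Unset Strict Implicit.
Unset Printing Implicit Defensive.

Import Order.TTheory GRing.Theory Num.Theory.
Import numFieldNormedType.Exports.
Import Normc.

Local Open Scope classical_set_scope.
Local Open Scope ring_scope.
Local Open Scope complex_scope.

Definition metrizable (R : realType) (T : topologicalType) : Prop :=
  exists d : T -> T -> R,
    [/\ forall x y, d x y = 0 <-> x = y,
        forall x y, d x y = d y x,
        forall x y z, d x z <= d x y + d y z &
        forall x : T,
          nbhs x = filter_from [set e : R | 0 < e] (fun e => [set y | d x y < e])].

HB.mixin Record isMetricSemigroup (R : realType) S
    of Semigroup S & PointedTopological S := {
  metrizableS : metrizable R S ;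
  mulg_continuous : continuous (fun xy : S * S => (xy.1 * xy.2)%g)
}.

(* The base point only records that S is nonempty; the library asks for one on
   every measurable type. *)
#[short(type="metricSemigroupType")]
HB.structure Definition MetricSemigroup (R : realType) :=
  { S of Semigroup S & PointedTopological S & isMetricSemigroup R S }.

Notation borel T := (g_sigma_algebraType (@open T)).

(* R[i]^o is R[i] with the topology of its modulus. *)

Section sup_norm.
Context {R : realType} {T : pointedType}.
Implicit Types f g : T -> R[i]^o.

(* Meaningful for bounded f only: the supremum of an unbounded set is 0. *)
Definition sup_norm f : R := sup (range (fun x => normc (f x))).

Lemma normrE_normc (z : R[i]^o) : `|z| = (normc z)%:C.
Proof. by []. Qed.

Lemma bounded_fun_normcP f :
  bounded_fun f <-> exists M : R, forall x, normc (f x) <= M.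
Proof.
split=> [[M [Mreal fM]]|[M fM]].
  have M1 : M < `|M| + 1.
    by rewrite (le_lt_trans (real_ler_norm Mreal))// ltrDl.
  exists (normc M + 1) => x.
  by have := fM _ M1 x I; rewrite /= normrE_normc -lecR rmorphD.
exists M%:C; split; first by rewrite complex_real.
move=> N MN x _ /=; apply: (le_trans _ (ltW MN)).
by rewrite normrE_normc lecR.
Qed.

Lemma normcD_le (z w : R[i]) : normc (z + w) <= normc z + normc w.
Proof. by rewrite -lecR rmorphD; exact: (@ler_normD _ (R[i])). Qed.

Lemma normc_ge0 (z : R[i]) : 0 <= normc z.
Proof. by case: z => a b; exact: sqrtr_ge0. Qed.

Lemma normc_le_sup_norm f x : bounded_fun f -> normc (f x) <= sup_norm f.
Proof.
move=> /bounded_fun_normcP[M fM]; apply: ub_le_sup; last by exists x.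
by exists M => _ [y _ <-].
Qed.

Lemma sup_norm_le f (M : R) : (forall x, normc (f x) <= M) -> sup_norm f <= M.
Proof.
move=> fM; apply: ge_sup; first by exists (normc (f point)), point.
by move=> _ [x _ <-].
Qed.

Lemma sup_norm_ge0 f : bounded_fun f -> 0 <= sup_norm f.
Proof.
by move=> bf; exact: le_trans (normc_ge0 (f point)) (normc_le_sup_norm _ bf).
Qed.

Lemma sup_norm0 : sup_norm 0 = 0.
Proof.
apply/eqP; rewrite eq_le sup_norm_le ?sup_norm_ge0// => [|x].
  by apply/bounded_fun_normcP; exists 0 => x; rewrite normc0.
by rewrite normc0.
Qed.

Lemma bounded_funZD (a : R[i]) f g :
  bounded_fun f -> bounded_fun g -> bounded_fun (a *: f + g).
Proof.
move=> /bounded_fun_normcP[M fM] /bounded_fun_normcP[N gN].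
apply/bounded_fun_normcP; exists (normc a * M + N) => x.
by rewrite (le_trans (normcD_le _ _))// lerD// normcM ler_wpM2l ?normc_ge0.
Qed.

Lemma sup_normZD (a : R[i]) f g : bounded_fun f -> bounded_fun g ->
  sup_norm (a *: f + g) <= normc a * sup_norm f + sup_norm g.
Proof.
move=> bf bg; apply: sup_norm_le => x.
rewrite (le_trans (normcD_le _ _))// lerD ?normc_le_sup_norm// normcM.
by rewrite ler_wpM2l ?normc_ge0 ?normc_le_sup_norm.
Qed.

End sup_norm.

Section LUC.
Context {R : realType} {S : metricSemigroupType R}.
Implicit Types (f g : S -> R[i]^o) (a b : S).

Definition translate a f : S -> R[i]^o := fun x => f (a * x)%g.

Definition is_luc f : Prop :=
  [/\ bounded_fun f, continuous f &
      forall a, sup_norm (translate b f - translate a f) @[b --> a] --> (0 : R)].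

Definition luc : {pred S -> R[i]^o} := mem [set f | is_luc f].

Lemma bounded_translate a f : bounded_fun f -> bounded_fun (translate a f).
Proof.
move=> /bounded_fun_normcP[M fM]; apply/bounded_fun_normcP.
by exists M => x; exact: fM.
Qed.

Lemma bounded_translateB a b f :
  bounded_fun f -> bounded_fun (translate b f - translate a f).
Proof.
move=> bf; rewrite addrC -scaleN1r.
by apply: bounded_funZD; exact: bounded_translate.
Qed.

Lemma continuous_mulgl a : continuous (fun x : S => (a * x)%g).
Proof.
move=> x; apply: (@cvg_comp2 _ _ _ _ _ (nbhs a) (nbhs x) _ _ _ _ (fun=> a) id
  (fun y z => (y * z)%g)); [exact: cvg_cst | exact: cvg_id |].
exact: (@mulg_continuous R S (a, x)).
Qed.

Lemma luc_submod_closed : submod_closed luc.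
Proof.
split=> [|c f g].
  rewrite inE; split=> [||a].
  - by apply/bounded_fun_normcP; exists 0 => x; rewrite normc0.
  - exact: cst_continuous.
  - rewrite (_ : (fun b => _) = cst 0); first exact: cvg_cst.
    by apply/funext => b; rewrite -[RHS](@sup_norm0 R S) subrr.
rewrite !inE => -[bf cf lf] [bg cg lg]; split=> [||a].
- exact: bounded_funZD.
- by move=> x; apply: cvgD; [apply: cvgZr; exact: cf | exact: cg].
- apply: (@squeeze_cvgr _ _ _ _ (cst 0) (fun b =>
    normc c * sup_norm (translate b f - translate a f) +
    sup_norm (translate b g - translate a g))).
  + near=> b.
    have -> : translate b (c *: f + g) - translate a (c *: f + g) =
       c *: (translate b f - translate a f) + (translate b g - translate a g).
      apply/funext => x; rewrite /translate !fctE/=.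
      by rewrite opprD addrACA -scalerBr.
    have [bf' bg'] := (bounded_translateB a b bf, bounded_translateB a b bg).
    by rewrite sup_norm_ge0 ?sup_normZD//; exact: bounded_funZD.
  + exact: cvg_cst.
  + have := cvgD (cvgM (cvg_cst (normc c)) (lf a)) (lg a).
    by rewrite mulr0 addr0; exact.
Unshelve. all: by end_near. Qed.

HB.instance Definition _ := GRing.isSubmodClosed.Build R[i] (S -> R[i]^o) luc
  luc_submod_closed.

End LUC.

Record LUC (R : realType) (S : metricSemigroupType R) := MkLUC {
  luc_fun :> S -> R[i]^o ;
  luc_funP : luc_fun \in luc
}.

HB.instance Definition _ (R : realType) (S : metricSemigroupType R) :=
  [isSub for @luc_fun R S].
HB.instance Definition _ (R : realType) (S : metricSemigroupType R) :=
  [Choice of LUC S by <:].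
HB.instance Definition _ (R : realType) (S : metricSemigroupType R) :=
  [SubChoice_isSubLmodule of LUC S by <:].

Section amenability.
Context {R : realType} {S : metricSemigroupType R}.

Lemma luc_translate (a : S) (f : LUC S) : translate a f \in luc.
Proof.
have := luc_funP f; rewrite !inE => -[bf cf lf]; split=> [||b].
- exact: bounded_translate.
- move=> x; apply: (@cvg_comp _ _ _ _ f); last exact: cf.
  exact: continuous_mulgl.
- have tt c : translate c (translate a f) = translate (a * c)%g f.
    by apply/funext => x; rewrite /translate mulgA.
  under eq_fun do rewrite !tt.
  apply: (@cvg_comp _ _ _ (fun c => (a * c)%g)
    (fun c => sup_norm (translate c f - translate (a * b)%g f))).
    exact: continuous_mulgl.
  exact: lf.
Qed.

Definition delta (a : S) (f : LUC S) : LUC S := MkLUC (luc_translate a f).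

Definition positive (phi : {scalar LUC S}) : Prop :=
  forall f : LUC S, (forall x, 0 <= (f x : R[i])) -> 0 <= phi f.

(* For unbounded phi the supremum is the default value 0, so that
   functional_norm phi = 1 entails that phi is bounded. *)
Definition functional_norm (phi : {scalar LUC S}) : R :=
  sup [set normc (phi f) | f in [set f : LUC S | sup_norm f <= 1]].

End amenability.

Definition amenable (R : realType) (S : metricSemigroupType R) : Prop :=
  exists phi : {scalar LUC S},
    [/\ functional_norm phi = 1, positive phi &
        forall (a : S) (f : LUC S), phi (delta a f) = phi f].

Section liouville.
Context {R : realType} {S : metricSemigroupType R}.
Implicit Type pi : probability (borel S) R.

Definition tight pi : Prop :=
  forall e : R, 0 < e -> exists K : set S, compact K /\ (pi (~` K) < e%:E)%E.

Definition complex_integral pi (f : S -> R[i]^o) : R[i] :=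
  (\int[pi]_x complex.Re (f x)) +i* (\int[pi]_x complex.Im (f x)).

Definition harmonic pi : set (LUC S) :=
  [set f : LUC S | forall x : S, f x = complex_integral pi (fun y => f (x * y)%g)].

End liouville.

Definition Liouville (R : realType) (S : metricSemigroupType R) : Prop :=
  exists pi : probability (borel S) R,
    tight pi /\
    harmonic pi = [set f : LUC S | exists c : R[i], forall x, f x = c].

(* Main.v *)
From HB Require Import structures.
Require Import Defs.
From mathcomp Require Import all_boot all_order all_algebra complex ring lra.
From mathcomp Require Import all_classical all_reals all_analysis.
From mathcomp Require Import measurable_realfun.

(** Let pi be a tight probability measure whose bounded left uniformly
continuous harmonic functions are constant, and let P be the operator sending g
to the function x |-> \int g(xy) dpi(y) ([markov]).  P is positive, fixes the
constants, and commutes with left translations.  For a real function g, take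
the averages of P g, ..., P^(n+1) g ([cesaro]) and their pointwise limit T g
along a nonprincipal ultrafilter on the natural numbers ([ultramean]).

The function T g is fixed by P.  The averages are almost fixed by P
([markov_cesaro]), so the point is to exchange the ultralimit with the
integral.  Dominated convergence can fail along an ultrafilter, but the
averages of g are equicontinuous with a modulus inherited from the translates
of g ([cesaro_close]); hence they converge uniformly on compact sets, and
tightness of pi does the rest ([tight_Rintegral_cvg], [markov_ultramean]).  The
same modulus shows that T g is left uniformly continuous.

By the Liouville hypothesis T g is therefore a constant m(g).  The functional m
is linear, positive and normalized because each average is, and it is left
invariant because T commutes with left translations ([ultramean_translate]) and
translating a constant does not change it.  A left invariant mean on real
functions gives one on complex functions ([amenable_real_mean]). *)

Set Implicit Arguments.
Unset Strict Implicit.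
Unset Printing Implicit Defensive.

Import Order.TTheory GRing.Theory Num.Theory.
Import numFieldNormedType.Exports.
Import Normc.

Local Open Scope classical_set_scope.
Local Open Scope ring_scope.

(** * Limits of integrals along an ultrafilter *)

Lemma bounded_ultra_cvg (R : realType) (I : Type) (U : set_system I)
    (UU : UltraFilter U) (u : I -> R) (M : R) :
  (forall n, `|u n| <= M) -> cvg (u @ U).
Proof.
move=> uM; have := @segment_compact R (- M) M; rewrite compact_ultra.
have UuU : UltraFilter (u @ U).
  split => [|G GP uUG]; first exact: fmap_proper_filter.
  apply/seteqP; split => // A GA.
  have [//|UnA] := in_ultra_setVsetC (u @^-1` A) UU.
  exfalso; apply: (@filter_not_empty _ G GP).
  by rewrite -(setICr A); apply: filterI => //; exact: uUG.
move=> /(_ (u @ U) UuU); case => [|l [_ ul]]; last by apply/cvg_ex; exists l.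
by apply: nearW => n /=; rewrite in_itv/= -ler_norml.
Qed.

Section integration.
Context {R : realType} {T : ptopologicalType} (pi : probability (borel T) R).

Lemma continuous_measurable_borel (g : T -> R) :
  continuous g -> measurable_fun [set: borel T] g.
Proof.
move=> /continuousP cg; apply: (measurability _ (RGenOpens.measurableE R)).
move=> _ [_ [a [b ->] <-]]; rewrite setTI; apply: sub_sigma_algebra.
exact/cg/interval_open.
Qed.

Lemma bounded_continuous_integrable (g : T -> R) (M : R) :
  continuous g -> (forall x, `|g x| <= M) ->
  pi.-integrable [set: borel T] (EFin \o g).
Proof.
move=> cg gM; apply: measurable_bounded_integrable => //.
- by rewrite (le_lt_trans (probability_le1 pi _)) ?ltry.
- exact: continuous_measurable_borel.
- exists M; split; first exact: num_real.
  by move=> N MN x _ /=; exact: le_trans (gM x) (ltW MN).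
Qed.

Lemma Rintegral_prob_cst (c : R) : \int[pi]_x c = c.
Proof. by rewrite Rintegral_cst// [X in fine X](probability_setT pi) mulr1. Qed.

Lemma normr_Rintegral_le (g : T -> R) (M : R) :
  continuous g -> (forall x, `|g x| <= M) -> `|\int[pi]_x g x| <= M.
Proof.
move=> cg gM; have ig := bounded_continuous_integrable cg gM.
apply: (le_trans (le_normr_Rintegral _ ig)) => //.
rewrite -[leRHS]Rintegral_prob_cst; apply: le_Rintegral => //.
- by have := integrable_norm ig.
- by apply: (@bounded_continuous_integrable _ `|M|) => //; exact: cst_continuous.
Qed.

(** Dominated convergence can fail along a filter without a countable base, such
as a nonprincipal ultrafilter.  Equicontinuity turns pointwise
convergence into uniform convergence on compact sets, and tightness makes the
mass outside a suitable compact set small, where only the uniform bound [M] is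
used. *)
Lemma tight_Rintegral_cvg (I : Type) (F : set_system I) (FF : ProperFilter F)
    (h : I -> T -> R) (g : T -> R) (M : R) :
  hausdorff_space T ->
  (forall e : R, 0 < e ->
    exists K : set T, compact K /\ (pi (~` K) < e%:E)%E) ->
  (forall n, continuous (h n)) ->
  (forall n x, `|h n x| <= M) ->
  (forall x (e : R), 0 < e ->
    \forall y \near x, forall n, `|h n y - h n x| <= e) ->
  (forall x, h n x @[n --> F] --> g x) ->
  \int[pi]_x h n x @[n --> F] --> \int[pi]_x g x.
Proof.
move=> T2 tpi ch hM hequi hg.
have gM x : `|g x| <= M.
  by apply: (cvgr_to_le (cvg_norm (hg x))); apply: nearW => n; exact: hM.
have gequi x (e : R) : 0 < e -> \forall y \near x, `|g y - g x| <= e.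
  move=> e0; near=> y.
  apply: (cvgr_to_le (cvg_norm (cvgB (hg y) (hg x)))); apply: nearW.
  by near: y; exact: hequi.
have cg : continuous g.
  move=> x; apply/cvgrPdist_le => e e0; near=> y; rewrite distrC.
  by near: y; exact: gequi.
have M0 : 0 <= M := le_trans (normr_ge0 _) (gM point).
apply/cvgrPdist_le => e e0.
(* The integrand differs from its limit by at most 3 * d on K, and by at most
   2 * M on the complement of K, whose measure is at most d. *)
pose d := e / (3 + 2 * M).
have D0 : 0 < 3 + 2 * M by lra.
have d0 : 0 < d by rewrite divr_gt0.
have [K [cK pK]] := tpi _ d0.
have mK : measurable (K : set (borel T)).
  rewrite -[K]setCK; apply: measurableC; apply: sub_sigma_algebra.
  by apply: closed_openC; exact: compact_closed.
have : \near F, K `<=` (fun n x => `|g x - h n x| <= 3 * d) F.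
  apply: (iffLR (compact_near_coveringP K) cK) => x Kx.
  have hgx : \forall n \near F, `|g x - h n x| <= d.
    by move/cvgrPdist_le : (hg x); exact.
  near=> y n.
  rewrite (_ : _ - _ = (g y - g x) + (g x - h n x) - (h n y - h n x)); last ring.
  have -> : 3 * d = d + d + d by ring.
  rewrite (le_trans (ler_normB _ _))// lerD//.
    rewrite (le_trans (ler_normD _ _))// lerD//.
    - by near: y; exact: gequi.
    - by near: n.
  by apply: (near (hequi x d d0) y).
apply: filterS => n hgn.
have ig := bounded_continuous_integrable cg gM.
have ih := bounded_continuous_integrable (ch n) (hM n).
rewrite -RintegralB//.
have igh : pi.-integrable [set: borel T] (EFin \o (fun x => g x - h n x)).
  by have := integrableB measurableT ig ih.
rewrite (le_trans (le_normr_Rintegral _ igh))//.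
have iC : pi.-integrable [set: borel T] (EFin \o (\1_(~` K) : T -> R)).
  by apply: integrable_indic; exact: measurableC.
have iD : pi.-integrable [set: borel T] (EFin \o cst (3 * d)).
  apply: (@bounded_continuous_integrable _ `|3 * d|) => //.
  exact: cst_continuous.
have iC2 := integrableZl measurableT (2 * M) iC.
apply: (@le_trans _ _ (\int[pi]_x (3 * d + (2 * M) * \1_(~` K) x))).
  apply: le_Rintegral => //.
  - by have := integrable_norm igh.
  - by have := integrableD measurableT iD iC2.
  - move=> x _; rewrite indicE; have [Kx|nKx] := boolP (x \in K).
      rewrite in_setC Kx mulr0 addr0; apply: hgn; exact: set_mem.
    rewrite in_setC nKx mulr1 (le_trans (ler_normB _ _))//.
    have := gM x; have := hM n x; lra.
rewrite RintegralD// RintegralZl// Rintegral_prob_cst.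
have -> : \int[pi]_x (\1_(~` K) x) = fine (pi (~` K)).
  by rewrite /Rintegral integral_indic ?setIT//; exact: measurableC.
have pd : fine (pi (~` K)) <= d.
  by rewrite -lee_fin fineK ?(ltW pK)// fin_num_measure//; exact: measurableC.
have -> : e = 3 * d + 2 * M * d by rewrite /d; field; rewrite gt_eqF.
by rewrite lerD2l ler_wpM2l// mulr_ge0.
Unshelve. all: by end_near. Qed.

End integration.

Lemma metrizable_hausdorff (R : realType) (T : topologicalType) :
  metrizable R T -> hausdorff_space T.
Proof.
move=> [d [d0 dC dD dnbhs]] p q pq; apply/d0/eqP/negPn/negP => dpq.
have dpp : d p p = 0 by apply/d0.
have r0 : 0 < d p q / 2.
  rewrite divr_gt0// lt_neqAle eq_sym dpq/=.
  by have := dD p q p; rewrite dpp (dC q p); lra.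
have ballP x : nbhs x [set y | d x y < d p q / 2].
  by rewrite dnbhs; exists (d p q / 2).
have [z [/= pz qz]] := pq _ _ (ballP p) (ballP q).
by have := dD p z q; rewrite (dC z q); lra.
Qed.

(** * Real left uniformly continuous functions *)

Section real_luc.
Context {R : realType} {S : metricSemigroupType R}.
Implicit Types (g h : S -> R) (a b x : S) (e M : R).

(** The left translates of [g] by [a] and by [b] are at sup distance at most
[e].  The form without a supremum is what passes to averages and to pointwise
limits without loss. *)
Definition translates_close g e a b : Prop :=
  forall x, `|g (a * x)%g - g (b * x)%g| <= e.

Definition real_luc g : Prop :=
  [/\ exists M, forall x, `|g x| <= M, continuous g &
      forall a e, 0 < e -> \forall b \near a, translates_close g e b a].

Lemma real_luc_cst (c : R) : real_luc (fun=> c).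
Proof.
split; first by exists `|c|.
  exact: cst_continuous.
by move=> a e e0; apply: nearW => b x; rewrite subrr normr0 ltW.
Qed.

Lemma real_luc_lin (c : R) g h :
  real_luc g -> real_luc h -> real_luc (fun x => c * g x + h x).
Proof.
move=> [[M gM] cg lg] [[N hN] ch lh]; split.
- exists (`|c| * M + N) => x.
  by rewrite (le_trans (ler_normD _ _))// lerD// normrM ler_wpM2l.
- by move=> x; apply: cvgD; [apply: cvgM; [exact: cvg_cst|exact: cg]|exact: ch].
- move=> a e e0.
  have c0 : 0 < `|c| + 1 by rewrite ltr_wpDl.
  have d0 : 0 < e / 2 / (`|c| + 1) by rewrite !divr_gt0.
  have e20 : 0 < e / 2 by rewrite divr_gt0.
  near=> b => x.
  rewrite (_ : _ - _ = c * (g (b * x)%g - g (a * x)%g)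
    + (h (b * x)%g - h (a * x)%g)); last by ring.
  rewrite (le_trans (ler_normD _ _))// [leRHS](splitr e) lerD//.
    rewrite normrM.
    have gba : `|g (b * x)%g - g (a * x)%g| <= e / 2 / (`|c| + 1).
      by apply: (near (lg a _ d0) b).
    rewrite (le_trans (ler_wpM2l (normr_ge0 c) gba))//.
    by rewrite mulrA ler_pdivrMr// mulrDr mulr1 mulrC lerDl ltW.
  by apply: (near (lh a _ e20) b).
Unshelve. all: by end_near. Qed.

Lemma real_luc_translate a g : real_luc g -> real_luc (fun x => g (a * x)%g).
Proof.
move=> [[M gM] cg lg]; split; first by exists M.
- move=> x; apply: (continuous_comp (f := fun y => (a * y)%g)); last exact: cg.
  exact: continuous_mulgl.
- move=> b e e0; have := lg (a * b)%g e e0.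
  move=> /(@continuous_mulgl _ _ a b) gab; near=> c => x; rewrite !mulgA.
  by move: x; near: c.
Unshelve. all: by end_near. Qed.

Lemma real_luc_sum n (F : 'I_n -> S -> R) :
  (forall k, real_luc (F k)) -> real_luc (fun x => \sum_(k < n) F k x).
Proof.
elim: n F => [|n IHn] F lF.
  by under eq_fun do rewrite big_ord0; exact: real_luc_cst.
under eq_fun do rewrite big_ord_recl.
have := real_luc_lin 1 (lF ord0) (IHn (fun k => F (lift ord0 k)) (fun k => lF _)).
by under eq_fun do rewrite mul1r.
Qed.

End real_luc.

(** * The convolution operator and its averages *)

Section markov_operator.
Context {R : realType} {S : metricSemigroupType R}.
Context (pi : probability (borel S) R).
Implicit Types (g h : S -> R) (a b x : S) (e M : R).

Definition markov g x : R := \int[pi]_y g (x * y)%g.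

Lemma markov_integrable g x : real_luc g ->
  pi.-integrable [set: borel S] (EFin \o (fun y => g (x * y)%g)).
Proof.
move=> /(real_luc_translate x)[[M gM] cg _].
exact: bounded_continuous_integrable cg gM.
Qed.

Lemma markov_cst (c : R) : markov (fun=> c) = (fun=> c).
Proof. by apply/funext => x; exact: Rintegral_prob_cst. Qed.

Lemma markov_lin (c : R) g h : real_luc g -> real_luc h ->
  markov (fun x => c * g x + h x) = (fun x => c * markov g x + markov h x).
Proof.
move=> lg lh; apply/funext => x; rewrite /markov.
have ig := markov_integrable x lg; have ih := markov_integrable x lh.
rewrite RintegralD ?RintegralZl//.
exact: (integrableZl measurableT c ig).
Qed.

(** Translating on the left commutes with averaging on the right; this is what
makes every mean built from [markov] left equivariant. *)
Lemma markov_translate a g :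
  markov (fun x => g (a * x)%g) = (fun x => markov g (a * x)%g).
Proof. by apply/funext => x; apply: eq_Rintegral => y _; rewrite mulgA. Qed.

Lemma markov_ge0 g : (forall x, 0 <= g x) -> forall x, 0 <= markov g x.
Proof. by move=> g0 x; exact: Rintegral_ge0. Qed.

Lemma markov_le g M : real_luc g -> (forall x, `|g x| <= M) ->
  forall x, `|markov g x| <= M.
Proof.
move=> /[swap] gM + x => /(real_luc_translate x)[_ cg _].
exact: normr_Rintegral_le.
Qed.

(** The modulus of continuity of the translates of [g] controls the function
[markov g] itself, so continuity of [markov g] needs no limit theorem, and the
same modulus serves all the iterates. *)
Lemma markov_close g e a b : real_luc g -> translates_close g e a b ->
  `|markov g a - markov g b| <= e.
Proof.
move=> lg gab; rewrite /markov -RintegralB//; try exact: markov_integrable.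
apply: normr_Rintegral_le => //.
have [_ ca _] := real_luc_translate a lg; have [_ cb _] := real_luc_translate b lg.
by move=> x; apply: cvgB; [exact: ca|exact: cb].
Qed.

Lemma markov_translates_close g e a b : real_luc g ->
  translates_close g e a b -> translates_close (markov g) e a b.
Proof.
move=> lg gab x; apply: markov_close => // y.
by rewrite -!mulgA; exact: gab.
Qed.

Lemma real_luc_markov g : real_luc g -> real_luc (markov g).
Proof.
move=> lg; have [[M gM] cg ug] := lg; split.
- by exists M; exact: markov_le.
- move=> x; apply/cvgrPdist_le => e e0; have := ug x e e0.
  by apply: filterS => y gyx; rewrite distrC; exact: markov_close.
- move=> a e e0; have := ug a e e0; apply: filterS => b.
  exact: markov_translates_close.
Qed.

Lemma markov_iter_ind (Q : (S -> R) -> Prop) n g :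
  (forall h, Q h -> Q (markov h)) -> Q g -> Q (iter n markov g).
Proof. by move=> QP Qg; elim: n => [|n IHn] //=; exact: QP. Qed.

Lemma real_luc_iter n g : real_luc g -> real_luc (iter n markov g).
Proof. by apply: markov_iter_ind; exact: real_luc_markov. Qed.

Lemma iter_markov_lin n (c : R) g h : real_luc g -> real_luc h ->
  iter n markov (fun x => c * g x + h x) =
  (fun x => c * iter n markov g x + iter n markov h x).
Proof.
move=> lg lh; elim: n => [|n IHn] //=.
by rewrite IHn markov_lin//; exact: real_luc_iter.
Qed.

(** The average starts at the first power of [markov] and not at the identity:
the bound of [cesaro_close] can fail for [g] itself, since without a unit in the
semigroup the values of [g] are not controlled by its translates. *)
Definition cesaro n g x : R := n.+1%:R^-1 * \sum_(k < n.+1) iter k.+1 markov g x.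

Lemma normr_cesaro_le n (u : 'I_n.+1 -> R) M : (forall k, `|u k| <= M) ->
  `|n.+1%:R^-1 * \sum_(k < n.+1) u k| <= M.
Proof.
move=> uM; rewrite normrM ger0_norm ?invr_ge0// ler_pdivrMl//.
rewrite (le_trans (ler_norm_sum _ _ _))//.
rewrite (le_trans (ler_sum _ (fun k _ => uM k)))//.
by rewrite sumr_const card_ord mulr_natl.
Qed.

Lemma real_luc_cesaro n g : real_luc g -> real_luc (cesaro n g).
Proof.
move=> lg.
have := real_luc_lin n.+1%:R^-1 (@real_luc_sum _ _ n.+1
  (fun k => iter k.+1 markov g) (fun k => real_luc_iter _ lg)) (real_luc_cst 0).
by under eq_fun do rewrite addr0.
Qed.

Lemma iter_markov_le n g M : real_luc g -> (forall x, `|g x| <= M) ->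
  forall x, `|iter n markov g x| <= M.
Proof.
move=> lg gM; apply: (proj2 (@markov_iter_ind (fun h => real_luc h /\
  forall x, `|h x| <= M) _ _ _ _)) => // h [lh hM].
by split; [exact: real_luc_markov|exact: markov_le].
Qed.

Lemma cesaro_le n g M : real_luc g -> (forall x, `|g x| <= M) ->
  forall x, `|cesaro n g x| <= M.
Proof.
by move=> lg gM x; apply: normr_cesaro_le => k; exact: iter_markov_le.
Qed.

Lemma cesaro_cst n (c : R) x : cesaro n (fun=> c) x = c.
Proof.
rewrite /cesaro (eq_bigr (fun=> c)) => [|k _].
  by rewrite sumr_const card_ord -[c *+ _]mulr_natl mulKf.
suff -> : iter k.+1 markov (fun=> c) = (fun=> c) by [].
apply: (@markov_iter_ind (fun h => h = fun=> c)) => // h ->.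
exact: markov_cst.
Qed.

Lemma cesaro_ge0 n g : (forall x, 0 <= g x) -> forall x, 0 <= cesaro n g x.
Proof.
move=> g0 x; rewrite mulr_ge0 ?invr_ge0// sumr_ge0// => k _; move: x.
by apply: (@markov_iter_ind (fun h => forall x, 0 <= h x)) => //; exact: markov_ge0.
Qed.

Lemma cesaro_lin n (c : R) g h x : real_luc g -> real_luc h ->
  cesaro n (fun x => c * g x + h x) x = c * cesaro n g x + cesaro n h x.
Proof.
move=> lg lh; rewrite /cesaro mulrCA -mulrDr; congr (_ * _).
rewrite mulr_sumr -big_split; apply: eq_bigr => k _.
by rewrite iter_markov_lin.
Qed.

Lemma cesaro_translate n a g x :
  cesaro n (fun x => g (a * x)%g) x = cesaro n g (a * x)%g.
Proof.
congr (_ * _); apply: eq_bigr => k _; move: x; apply/funeqP.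
elim: k.+1 => [//|j /= ->]; exact: markov_translate.
Qed.

(** The family of all averages of [g] is equicontinuous. *)
Lemma cesaro_close n g e a b : real_luc g -> translates_close g e a b ->
  `|cesaro n g a - cesaro n g b| <= e.
Proof.
move=> lg gab; rewrite -mulrBr -sumrB; apply: normr_cesaro_le => k.
have [lh hab] : real_luc (iter k markov g) /\
    translates_close (iter k markov g) e a b.
  apply: (@markov_iter_ind (fun h => real_luc h /\ translates_close h e a b)).
    move=> h [lh hab]; split; first exact: real_luc_markov.
    exact: markov_translates_close.
  by [].
exact: markov_close.
Qed.

Lemma markov_sum n (F : 'I_n -> S -> R) : (forall k, real_luc (F k)) ->
  markov (fun x => \sum_(k < n) F k x) = (fun x => \sum_(k < n) markov (F k) x).
Proof.
elim: n F => [|n IHn] F lF.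
  under eq_fun do rewrite big_ord0; under [RHS]eq_fun do rewrite big_ord0.
  exact: markov_cst.
under eq_fun do rewrite big_ord_recl -[X in X + _]mul1r.
rewrite (markov_lin 1 (lF ord0) (real_luc_sum (fun k => lF (lift ord0 k)))).
by apply/funext => x; rewrite IHn// mul1r big_ord_recl.
Qed.

(** The sum telescopes, so the averages are [markov]-invariant up to an error of
order 1/n. *)
Lemma markov_cesaro n g x : real_luc g ->
  markov (cesaro n g) x =
  cesaro n g x + n.+1%:R^-1 * (iter n.+2 markov g x - markov g x).
Proof.
move=> lg.
have lk (k : 'I_n.+1) : real_luc (iter k.+1 markov g) by exact: real_luc_iter.
have := markov_lin n.+1%:R^-1 (real_luc_sum lk) (real_luc_cst 0).
under eq_fun do rewrite addr0.
rewrite /cesaro => ->; rewrite markov_cst addr0 -mulrDr markov_sum//.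
congr (_ * _); apply/eqP; rewrite addrC -subr_eq -sumrB.
rewrite -(big_mkord xpredT (fun k => iter k.+2 markov g x - iter k.+1 markov g x)).
by rewrite (telescope_sumr (fun k => iter k.+1 markov g x)).
Qed.

End markov_operator.

(** * Ultralimits of the averages are harmonic *)

Section ultralimit.
Context {R : realType} {S : metricSemigroupType R}.
Context (pi : probability (borel S) R) (U : set_system nat).
Context {UU : UltraFilter U}.
Implicit Types (g h : S -> R) (a b x : S) (e M : R).

Definition ultramean g x : R := lim (cesaro pi n g x @[n --> U]).

Lemma cvg_ultramean g x : real_luc g ->
  cesaro pi n g x @[n --> U] --> ultramean g x.
Proof.
move=> lg; have [[M gM] _ _] := lg.
by apply: (@bounded_ultra_cvg _ _ _ _ _ M) => n; exact: cesaro_le.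
Qed.

Arguments cvg_ultramean [g] x _ [t] _.

Lemma ultramean_le g M : real_luc g -> (forall x, `|g x| <= M) ->
  forall x, `|ultramean g x| <= M.
Proof.
move=> lg gM x; apply: (cvgr_to_le (cvg_norm (cvg_ultramean x lg))).
by apply: nearW => n; exact: cesaro_le.
Qed.

Lemma ultramean_cst (c : R) x : ultramean (fun=> c) x = c.
Proof.
apply: cvg_lim; first exact: norm_hausdorff.
under eq_fun do rewrite cesaro_cst.
exact: cvg_cst.
Qed.

Lemma ultramean_ge0 g : real_luc g -> (forall x, 0 <= g x) ->
  forall x, 0 <= ultramean g x.
Proof.
move=> lg g0 x; apply: (cvgr_to_ge (cvg_ultramean x lg)).
by apply: nearW => n; exact: cesaro_ge0.
Qed.

Lemma ultramean_lin (c : R) g h x : real_luc g -> real_luc h ->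
  ultramean (fun x => c * g x + h x) x = c * ultramean g x + ultramean h x.
Proof.
move=> lg lh; apply: cvg_lim; first exact: norm_hausdorff.
under eq_fun do rewrite cesaro_lin//.
apply: cvgD; last exact: cvg_ultramean.
by apply: cvgM; [exact: cvg_cst|exact: cvg_ultramean].
Qed.

Lemma ultramean_translate a g x :
  ultramean (fun x => g (a * x)%g) x = ultramean g (a * x)%g.
Proof.
by rewrite /ultramean; under eq_fun do rewrite cesaro_translate.
Qed.

Lemma ultramean_close g e a b : real_luc g -> translates_close g e a b ->
  `|ultramean g a - ultramean g b| <= e.
Proof.
move=> lg gab.
apply: (cvgr_to_le (cvg_norm (cvgB (cvg_ultramean a lg) (cvg_ultramean b lg)))).
by apply: nearW => n; exact: cesaro_close.
Qed.

Lemma real_luc_ultramean g : real_luc g -> real_luc (ultramean g).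
Proof.
move=> lg; have [[M gM] _ ug] := lg; split.
- by exists M; exact: ultramean_le.
- move=> x; apply/cvgrPdist_le => e e0; have := ug x e e0.
  by apply: filterS => y gyx; rewrite distrC; exact: ultramean_close.
- move=> a e e0; have := ug a e e0; apply: filterS => b gba x.
  by apply: ultramean_close => // y; rewrite -!mulgA; exact: gba.
Qed.

(** The operator [markov] passes through the ultralimit by
[tight_Rintegral_cvg], and the limit of the averages is then invariant by
[markov_cesaro]. *)
Lemma markov_ultramean g : tight pi -> \oo `<=` U -> real_luc g ->
  markov pi (ultramean g) = ultramean g.
Proof.
move=> tpi ooU lg; have [[M gM] _ ug] := lg; apply/funext => x.
have hR := @norm_hausdorff _ R.
apply: (@cvg_unique _ hR (markov pi (cesaro pi n g) x @[n --> U])).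
  apply: (@tight_Rintegral_cvg _ _ _ _ _ _ (fun n y => cesaro pi n g (x * y)%g)
    (fun y => ultramean g (x * y)%g) M _ tpi).
  + exact: metrizable_hausdorff (@metrizableS R S).
  + by move=> n; have [] := real_luc_translate x (real_luc_cesaro pi n lg).
  + by move=> n y; exact: cesaro_le.
  + move=> y e e0; have := @continuous_mulgl _ _ x y _ (ug (x * y)%g e e0).
    move=> uxy; near=> z => n; apply: cesaro_close => //.
    by near: z.
  + by move=> y; exact: cvg_ultramean.
under [X in X @ _]eq_fun do rewrite markov_cesaro//.
rewrite -[ultramean g x]addr0; apply: cvgD; first exact: cvg_ultramean.
apply: (cvg_trans (cvg_app _ ooU)).
apply/cvgrPdist_le => e e0.
have c0 := @cvg_harmonic R.
have : (sequences.harmonic n * (2 * M + 1)) @[n --> \oo] --> (0 : R).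
  by rewrite -[X in _ --> X](mul0r (2 * M + 1)); apply: cvgM => //; exact: cvg_cst.
move/cvgrPdist_le => /(_ e e0); apply: filterS => n.
rewrite !sub0r !normrN; apply: le_trans.
have iterM k : `|iter k (markov pi) g x| <= M by exact: iter_markov_le.
rewrite [leRHS]normrM normrM ler_wpM2l//.
rewrite (le_trans (ler_normB _ _))//.
have M0 := le_trans (normr_ge0 _) (gM x).
have := iterM n.+2; have := iterM 1%N => /=.
by rewrite (@ger0_norm _ (2 * M + 1)); lra.
Unshelve. all: by end_near. Qed.

End ultralimit.

(** * From real means to complex functionals *)

Local Open Scope complex_scope.

Lemma normr_Re_le (R : realType) (z : R[i]) : `|complex.Re z| <= normc z.
Proof. by rewrite -lecR; exact: normc_ge_Re. Qed.

Lemma normr_Im_le (R : realType) (z : R[i]) : `|complex.Im z| <= normc z.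
Proof.
case: z => a b /=; rewrite -sqrtr_sqr ler_wsqrtr// lerDr; exact: sqr_ge0.
Qed.

Lemma normc_real (R : realType) (x : R) : normc x%:C = `|x|.
Proof. by rewrite /= expr0n addr0 sqrtr_sqr. Qed.

Lemma normc_realB (R : realType) (x y : R) : normc (x%:C - y%:C) = `|x - y|.
Proof. by rewrite -rmorphB normc_real. Qed.

Section real_complex_luc.
Context {R : realType} {S : metricSemigroupType R}.

Lemma real_luc_comp (p : R[i] -> R) (f : LUC S) :
  (forall z w, p z - p w = p (z - w)) -> (forall z, `|p z| <= normc z) ->
  real_luc (fun x => p (f x)).
Proof.
move=> pB pn; have := luc_funP f; rewrite inE => -[bf cf lf]; split.
- have [M fM] := (bounded_fun_normcP f).1 bf.
  by exists M => x; exact: le_trans (pn _) (fM x).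
- move=> x; apply/cvgrPdist_le => e e0.
  have eC0 : (0 : R[i]) < e%:C by rewrite ltcR.
  have := cf x; move/cvgrPdist_le => /(_ e%:C eC0); apply: filterS => y.
  by rewrite normrE_normc lecR pB; exact: le_trans.
- move=> a e e0; have := lf a; move/cvgrPdist_le => /(_ e e0).
  apply: filterS => b; rewrite sub0r normrN => lab x.
  rewrite pB (le_trans (pn _))// (le_trans _ (le_trans (ler_norm _) lab))//.
  exact: (normc_le_sup_norm x (bounded_translateB a b bf)).
Qed.

Lemma real_luc_Re (f : LUC S) : real_luc (fun x => complex.Re (f x)).
Proof.
apply: real_luc_comp (@normr_Re_le R).
by move=> [a b] [c d].
Qed.

Lemma real_luc_Im (f : LUC S) : real_luc (fun x => complex.Im (f x)).
Proof.
apply: real_luc_comp (@normr_Im_le R).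
by move=> [a b] [c d].
Qed.

Lemma luc_of_real (g : S -> R) : real_luc g ->
  (fun x => (g x)%:C : R[i]^o) \in @luc R S.
Proof.
move=> [[M gM] cg lg]; rewrite inE; split.
- by apply/bounded_fun_normcP; exists M => x; rewrite normc_real.
- move=> x; apply/cvgrPdist_le => e; rewrite ltcE/= => /andP[/eqP e0 e1].
  have /cvgrPdist_le/(_ _ e1) := cg x; apply: filterS => y.
  rewrite normrE_normc [normc _]normc_realB => gxy.
  by rewrite lecE/= e0 eqxx.
- move=> a; apply/cvgrPdist_le => e e0; have := lg a e e0.
  apply: filterS => b gab; rewrite sub0r normrN ger0_norm.
    apply: sup_norm_le => x; rewrite [normc _]normc_realB; exact: gab.
  apply/sup_norm_ge0/bounded_translateB/bounded_fun_normcP.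
  by exists M => x; rewrite normc_real.
Qed.

Definition real_LUC (g : S -> R) (lg : real_luc g) : LUC S :=
  MkLUC (luc_of_real lg).

(** A left invariant mean on the real functions extends to the complex ones
through real and imaginary parts.  The bound on the norm of the extension is
the usual rotation argument: if the functional takes the value u + iv at [f],
then |u + iv|^2 is the mean of the real part of (u - iv) f, which is at most
|u + iv| when [f] has sup norm at most 1. *)
Lemma amenable_real_mean (m : (S -> R) -> R) :
  (forall (c : R) g h, real_luc g -> real_luc h ->
    m (fun x => c * g x + h x) = c * m g + m h) ->
  (forall c : R, m (fun=> c) = c) ->
  (forall g, real_luc g -> (forall x, 0 <= g x) -> 0 <= m g) ->
  (forall a g, real_luc g -> m (fun x => g (a * x)%g) = m g) ->
  amenable S.
Proof.
move=> mlin mcst m0 mtr.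
have mle g (M : R) : real_luc g -> (forall x, g x <= M) -> m g <= M.
  move=> lg gM; rewrite -subr_ge0.
  have := m0 (fun x => (-1) * g x + M).
  rewrite mlin ?mcst; [|exact: lg|exact: real_luc_cst].
  rewrite mulN1r addrC; apply => [|x].
    by apply: real_luc_lin => //; exact: real_luc_cst.
  by rewrite mulN1r addrC subr_ge0.
pose phi (f : LUC S) : R[i]^o :=
  m (fun x => complex.Re (f x)) +i* m (fun x => complex.Im (f x)).
have phi_lin : linear_for *%R phi.
  move=> [p q] f g; rewrite /phi/=; apply/eqP; rewrite eq_complex/=.
  have [lRf lIf] := (real_luc_Re f, real_luc_Im f).
  have [lRg lIg] := (real_luc_Re g, real_luc_Im g).
  apply/andP; split; apply/eqP.
  - transitivity (m (fun x => p * complex.Re (f x) +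
        ((- q) * complex.Im (f x) + complex.Re (g x)))).
      congr m; apply/funext => x.
      change (complex.Re ((p +i* q) * f x + g x) = p * complex.Re (f x) +
        ((- q) * complex.Im (f x) + complex.Re (g x))).
      by case: (f x) (g x) => [a b] [c d] /=; ring.
    by rewrite !mlin//; [ring|exact: real_luc_lin].
  - transitivity (m (fun x => p * complex.Im (f x) +
        (q * complex.Re (f x) + complex.Im (g x)))).
      congr m; apply/funext => x.
      change (complex.Im ((p +i* q) * f x + g x) = p * complex.Im (f x) +
        (q * complex.Re (f x) + complex.Im (g x))).
      by case: (f x) (g x) => [a b] [c d] /=; ring.
    by rewrite !mlin//; [ring|exact: real_luc_lin].
pose Phi := HB.pack_for {scalar LUC S} phi
  (GRing.isLinear.Build R[i] (LUC S) R[i] *%R phi phi_lin).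
have normPhi (f : LUC S) : sup_norm f <= 1 -> normc (Phi f) <= 1.
  move=> f1.
  have bf : bounded_fun f by have := luc_funP f; rewrite inE => -[].
  set u := m (fun x => complex.Re (f x)); set v := m (fun x => complex.Im (f x)).
  have r0 := normc_ge0 (Phi f).
  have rr : normc (Phi f) ^+ 2 = u ^+ 2 + v ^+ 2.
    by rewrite /= sqr_sqrtr// addr_ge0// sqr_ge0.
  have : m (fun x => u * complex.Re (f x) + (v * complex.Im (f x) + 0)) <=
      normc (Phi f).
    apply: mle => [|x].
      apply: real_luc_lin; first exact: real_luc_Re.
      by apply: real_luc_lin; [exact: real_luc_Im|exact: real_luc_cst].
    have -> : u * complex.Re (f x) + (v * complex.Im (f x) + 0) =
        complex.Re ((u -i* v) * f x).
      by case: (f x) => a b /=; ring.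
    rewrite (le_trans (ler_norm _))// (le_trans (normr_Re_le _))// normcM.
    have -> : normc (u -i* v) = normc (Phi f) by rewrite /= sqrrN.
    rewrite -[leRHS]mulr1 ler_wpM2l//.
    exact: le_trans (normc_le_sup_norm x bf) f1.
  rewrite mlin; [|exact: real_luc_Re|]; last first.
    by apply: real_luc_lin; [exact: real_luc_Im|exact: real_luc_cst].
  rewrite mlin; [|exact: real_luc_Im|exact: real_luc_cst].
  rewrite mcst addr0 -/u -/v -!expr2 -rr => rle.
  by rewrite leNgt; apply/negP => r1; nra.
exists Phi; split.
- pose one := real_LUC (@real_luc_cst R S 1).
  have one1 : normc (Phi one) = 1.
    by rewrite /= !mcst expr0n addr0 expr1n sqrtr1.
  have onein : [set normc (Phi f) | f in [set f : LUC S | sup_norm f <= 1]] 1.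
    exists one => //=; apply: sup_norm_le => x.
    by rewrite normc_real normr1.
  apply/eqP; rewrite eq_le; apply/andP; split.
    by apply: ge_sup; [exists 1|move=> _ [f f1 <-]; exact: normPhi].
  by apply: ub_le_sup => //; exists 1 => _ [f f1 <-]; exact: normPhi.
- move=> f f0; rewrite lecE/=; apply/andP; split.
    rewrite (_ : (fun x => complex.Im (f x)) = (fun=> 0)) ?mcst//.
    by apply/funext => x; have := f0 x; rewrite lecE/= => /andP[/eqP].
  apply: m0; first exact: real_luc_Re.
  by move=> x; have := f0 x; rewrite lecE/= => /andP[].
- move=> a f; congr (_ +i* _).
    exact: (mtr a _ (real_luc_Re f)).
  exact: (mtr a _ (real_luc_Im f)).
Qed.

End real_complex_luc.

Theorem theorem6p15 (R : realType) (S : metricSemigroupType R) :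
  Liouville S -> amenable S.
Proof.
move=> [pi [tpi Hpi]].
have [U [UU ooU]] := ultraFilterLemma eventually_filter.
(* The ultralimit of the averages of g is harmonic, hence constant. *)
have ultra_cst g : real_luc g -> forall x, ultramean pi U g x = ultramean pi U g point.
  move=> lg.
  have lT : real_luc (ultramean pi U g) by exact: real_luc_ultramean.
  have [c cE] : [set f : LUC S | exists c : R[i], forall x, f x = c] (real_LUC lT).
    rewrite -Hpi => x /=; rewrite /complex_integral/= Rintegral_prob_cst.
    congr (_ +i* _).
    exact: (esym (congr1 (fun h => h x) (markov_ultramean tpi ooU lg))).
  by move=> x; have := cE x; rewrite -(cE point) => -[].
apply: (@amenable_real_mean R S (fun g => ultramean pi U g point)).
- by move=> c g h lg lh; exact: ultramean_lin.
- by move=> c; exact: ultramean_cst.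
- by move=> g lg g0; exact: ultramean_ge0.
- by move=> a g lg; rewrite ultramean_translate ultra_cst.
Qed.
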